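(* Let $n\ge1$ and let $\mathcal S=\{S_0,S_{+1},S_{-1},S_+,S_-,S_F\}$ be a partition of $S_{n,n}=[n]\times[n]$ (parts may be empty). There exists an $\mathcal S$-compatible alternating sign matrix if and only if $$|\mathcal I|\ge n+|S_{-1}\cap I_0|+|S_{+1}\cap I_2|$$ holds for every $\mathcal S$-feasible separated family $\mathcal I=\mathcal I^1\uplus\mathcal I^2$ of segments, where $I_0$ is the set of positions covered by no member of $\mathcal I$ and $I_2$ is the set of positions covered by both a member of $\mathcal I^1$ and a member of $\mathcal I^2$.
   Context: An alternating sign matrix (ASM) is a $(0,\pm1)$-valued $n\times n$ matrix whose row and column sums are all $1$ and whose nonzero entries alternate in sign in each row and column. A matrix is $\mathcal S$-compatible if its entries at positions in $S_0$, $S_{+1}$, $S_{-1}$ are $0$, $+1$, $-1$ respectively, its entries at positions in $S_+$ are non-negative, its entries at positions in $S_-$ are non-positive, and positions in $S_F$ are unrestricted. Horizontal (vertical) segments are sets of consecutive positions in a row (column). A separated system of horizontal segments is a set of pairwise disjoint horizontal segments each of which is a maximal horizontal segment of their union; analogously for vertical. A separated family of segments is $\mathcal I=\mathcal I^1\uplus\mathcal I^2$ with $\mathcal I^1$ a separated system of horizontal segments and $\mathcal I^2$ a separated system of vertical segments, taken with multiplicity (a one-element segment in both counts twice); $|\mathcal I|=|\mathcal I^1|+|\mathcal I^2|$. $\mathcal I$ is $\mathcal S$-feasible if $I_0\subseteq S_0\cup S_{-1}\cup S_-$ and $I_2\subseteq S_0\cup S_{+1}\cup S_+$ (equivalently,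 $\mathcal I$ covers positions of $S_F$ exactly once, positions of $S_-\cup S_{-1}$ at most once, and positions of $S_+\cup S_{+1}$ at least once). *)

(* Defs.v *)
From mathcomp Require Import all_boot all_order all_algebra.
Set Implicit Arguments. Unset Strict Implicit. Unset Printing Implicit Defensive.
Import GRing.Theory Num.Theory.
Local Open Scope ring_scope.

Section Positions.

Variable n : nat.

Definition pos : Type := ('I_n * 'I_n)%type.

Definition rows_alternate (A : 'M[int]_n) : Prop :=
  forall i j k : 'I_n, (j < k)%N -> A i j != 0 -> A i k != 0 ->
    (forall l : 'I_n, (j < l < k)%N -> A i l = 0) -> A i j * A i k < 0.

Definition is_ASM (A : 'M[int]_n) : Prop :=
  [/\ forall i j, A i j \in [:: 0; 1; -1],
      forall i, \sum_j A i j = 1,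
      forall j, \sum_i A i j = 1,
      rows_alternate A
    & rows_alternate A^T].

(* Indices of the parts S_0, S_{+1}, S_{-1}, S_+, S_-, S_F. *)
Inductive label := Zero | PlusOne | MinusOne | NonNeg | NonPos | Free.

(* Unlike [finset.partition], empty parts are allowed. *)
Definition is_partition (S : label -> {set pos}) : Prop :=
  (forall a b, a <> b -> [disjoint S a & S b]) /\
  (forall p, exists a, p \in S a).

Definition compatible (S : label -> {set pos}) (A : 'M[int]_n) : Prop :=
  [/\ forall p, p \in S Zero -> A p.1 p.2 = 0,
      forall p, p \in S PlusOne -> A p.1 p.2 = 1,
      forall p, p \in S MinusOne -> A p.1 p.2 = -1,
      forall p, p \in S NonNeg -> 0 <= A p.1 p.2
    & forall p, p \in S NonPos -> A p.1 p.2 <= 0].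

(* Segments are nonempty. *)
Definition hsegment (X : {set pos}) : bool :=
  [exists i : 'I_n, exists a : 'I_n, exists b : 'I_n,
     (a <= b)%N && (X == [set p : pos | (p.1 == i) && (a <= p.2 <= b)%N])].

Definition vsegment (X : {set pos}) : bool :=
  [exists j : 'I_n, exists a : 'I_n, exists b : 'I_n,
     (a <= b)%N && (X == [set p : pos | (p.2 == j) && (a <= p.1 <= b)%N])].

Definition separated_system (seg : {set pos} -> bool) (I : {set {set pos}}) :
    Prop :=
  trivIset I /\
  (forall X, X \in I ->
     maxset (fun Y : {set pos} => seg Y && (Y \subset cover I)) X).

Definition separated_family (I1 I2 : {set {set pos}}) : Prop :=
  separated_system hsegment I1 /\ separated_system vsegment I2.

Definition uncovered (I1 I2 : {set {set pos}}) : {set pos} :=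
  ~: (cover I1 :|: cover I2).

Definition twice_covered (I1 I2 : {set {set pos}}) : {set pos} :=
  cover I1 :&: cover I2.

Definition feasible (S : label -> {set pos}) (I1 I2 : {set {set pos}}) : Prop :=
  uncovered I1 I2 \subset S Zero :|: S MinusOne :|: S NonPos /\
  twice_covered I1 I2 \subset S Zero :|: S PlusOne :|: S NonNeg.

End Positions.

(* Main.v *)
Require Import Defs.
From mathcomp Require Import all_boot all_order all_algebra.
From mathcomp Require Import zify.

(** An integer matrix is an ASM iff all its row and column prefix sums lie in
    {0, 1} and all its row and column sums equal 1. Prefix sums are flows: split
    each position p into a row node and a column node, let the row prefix sums
    flow along the rows, the column prefix sums flow up the columns, and the entry
    at p flow from the column node of p to its row node. Compatible ASMs are
    then the integral flows within given bounds, and Hoffman's theorem says that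
    one exists iff no cut is violated. A cut X corresponds to the family whose
    horizontal segments are the maximal segments of the row nodes in X and whose
    vertical segments are the maximal segments of the column nodes outside X; the
    cuts of finite capacity are the feasible families, and nonnegativity of the
    cut is the stated inequality. For the easy direction, summing the entries over the
    segments suffices, because each segment of an ASM has sum at most 1. *)

Set Implicit Arguments.
Unset Strict Implicit.
Unset Printing Implicit Defensive.
Import Order.TTheory GRing.Theory Num.Theory.

(** * Hoffman's theorem for integral flows with lower and upper bounds *)

Section Hoffman.
Local Open Scope ring_scope.

(* An endpoint [None] is the outside world: no conservation is required there. *)
Variables (V E : finType) (src tgt : E -> option V).
Implicit Types (X Y : {set V}) (l u f : E -> int).

Definition inside X (o : option V) : bool := if o is Some v then v \in X else false.

Definition leaves X e := inside X (src e) && ~~ inside X (tgt e).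
Definition enters X e := ~~ inside X (src e) && inside X (tgt e).

(** Bounds the net flow out of X from above; conservation makes that flow 0, so a flow forces
    nonnegative cuts. *)
Definition cut l u X : int := \sum_e (u e *+ leaves X e - l e *+ enters X e).

Lemma insideI X Y o : inside (X :&: Y) o = inside X o && inside Y o.
Proof. by case: o => //= v; rewrite inE. Qed.

Lemma insideU X Y o : inside (X :|: Y) o = inside X o || inside Y o.
Proof. by case: o => //= v; rewrite inE. Qed.

(** Submodularity, arc by arc. The arc e runs from X minus Y to Y minus X, so it crosses neither the
    intersection nor the union, and [u e - l e] is gained. *)
Lemma cut_uncross l u X Y e : (forall e, l e <= u e) ->
  leaves X e -> enters Y e ->
  cut l u (X :&: Y) + cut l u (X :|: Y) + (u e - l e) <= cut l u X + cut l u Y.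
Proof.
move=> lu eX eY; rewrite /cut -!big_split /= (bigD1 e) //= [leRHS](bigD1 e) //=.
rewrite [leLHS]addrAC lerD //.
  move: eX eY; rewrite /leaves /enters !insideI !insideU.
  by do 4!case: (inside _ _) => //=; rewrite ?mulr1n ?mulr0n; lia.
apply: ler_sum => a _; have := lu a; rewrite /leaves /enters !insideI !insideU.
by do 4!case: (inside _ _) => //=; rewrite ?mulr1n ?mulr0n; lia.
Qed.

Lemma sum_indicator e (P : pred E) : \sum_a ((a == e)%:R *+ P a : int) = (P e)%:R.
Proof.
rewrite (bigD1 e) //= eqxx big1 ?addr0 ?mulr1n // => a /negPf ->.
by rewrite mul0rn.
Qed.

Lemma cut_decr_upper l u X e :
  cut l (fun a => u a - (a == e)%:R) X = cut l u X - (leaves X e)%:R.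
Proof.
rewrite /cut -(sum_indicator e (leaves X)) -sumrB; apply: eq_bigr => a _.
by rewrite mulrnBl addrAC.
Qed.

Lemma cut_incr_lower l u X e :
  cut (fun a => l a + (a == e)%:R) u X = cut l u X - (enters X e)%:R.
Proof.
rewrite /cut -(sum_indicator e (enters X)) -sumrB; apply: eq_bigr => a _.
by rewrite mulrnDl opprD addrA.
Qed.

(** For [u = l] the cut is additive on a set and its complement. Two nonnegative cuts with sum at
    most 0 both vanish, and [cut l u [set v]] is the imbalance at v. *)
Lemma cut_fixed_conservation l u : (forall e, u e = l e) ->
  (forall X, 0 <= cut l u X) -> cut l u setT <= 0 ->
  forall v, \sum_(e | src e == Some v) l e = \sum_(e | tgt e == Some v) l e.
Proof.
move=> ul cut0 cutT v; apply/eqP; rewrite -subr_eq0.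
have -> : \sum_(e | src e == Some v) l e - \sum_(e | tgt e == Some v) l e
          = cut l u [set v].
  rewrite big_mkcond [X in _ - X]big_mkcond -sumrB; apply: eq_bigr => e _.
  rewrite ul /leaves /enters.
  have in1 o : inside [set v] o = (o == Some v) by case: o => //= w; rewrite inE.
  by rewrite !in1; do 2!case: (_ == _) => //=; rewrite ?mulr1n ?mulr0n; lia.
have cutC : cut l u [set v] + cut l u (~: [set v]) = cut l u setT.
  rewrite -big_split /=; apply: eq_bigr => e _; rewrite ul /leaves /enters.
  have inC o : inside (~: [set v]) o = inside setT o && ~~ inside [set v] o.
    by case: o => //= w; rewrite !inE.
  have in1 o : inside [set v] o = inside setT o && inside [set v] o.
    by case: o => //= w; rewrite !inE.
  rewrite !inC (in1 (src e)) (in1 (tgt e)).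
  move: (inside setT (src e)) (inside setT (tgt e)).
  move: (inside [set v] (src e)) (inside [set v] (tgt e)).
  by do 4![case] => //=; rewrite ?mulr1n ?mulr0n; lia.
have := cut0 [set v]; have := cut0 (~: [set v]); lia.
Qed.

(* Shrink the intervals [l e, u e] one unit at a time: if neither end of the
   interval at e can be moved, two tight cuts cross at e, contradicting
   [cut_uncross]. *)
Theorem hoffman_flow l u : (forall e, l e <= u e) ->
  (forall X, 0 <= cut l u X) -> cut l u setT <= 0 ->
  exists f, (forall e, l e <= f e <= u e) /\
    forall v, \sum_(e | src e == Some v) f e = \sum_(e | tgt e == Some v) f e.
Proof.
have [k] := ubnP `|(\sum_e (u e - l e))%R|%N.
elim: k l u => // k IH l u ltk lu cut0 cutT.
have [/forallP fixed|/forallPn[e lt_e]] := boolP [forall e, u e == l e].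
  exists l; split=> [e|]; first by rewrite lexx lu.
  by apply: (@cut_fixed_conservation l u) => // e; apply/eqP.
have {}lt_e : l e < u e by have := lu e; lia.
have sum1 : \sum_a (a == e)%:R = 1 :> int.
  by rewrite (bigD1 e) //= eqxx big1 // => a /negPf ->.
have sum_gt0 : 0 < \sum_a (u a - l a).
  by rewrite (bigD1 e) //= ltr_pwDl ?subr_gt0 ?sumr_ge0 // => a _; rewrite subr_ge0.
pose u' a := u a - (a == e)%:R; pose l' a := l a + (a == e)%:R.
have [/forallP cutu|/forallPn[X cutX]] := boolP [forall X, 0 <= cut l u' X].
  have [|a|//||f [fB fC]] := IH l u'.
  - rewrite (_ : \sum_e0 _ = \sum_a (u a - l a) - \sum_a (a == e)%:R).
      by rewrite sum1; lia.
    by rewrite -sumrB; apply: eq_bigr => a _; rewrite addrAC.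
  - by rewrite /u'; have := lu a; case: eqP => [->|] /=; lia.
  - by rewrite cut_decr_upper; lia.
  - by exists f; split=> // a; have := fB a; rewrite /u'; lia.
have [/forallP cutl|/forallPn[Y cutY]] := boolP [forall X, 0 <= cut l' u X].
  have [|a|//||f [fB fC]] := IH l' u.
  - rewrite (_ : \sum_e0 _ = \sum_a (u a - l a) - \sum_a (a == e)%:R).
      by rewrite sum1; lia.
    by rewrite -sumrB; apply: eq_bigr => a _; rewrite opprD addrA.
  - by rewrite /l'; have := lu a; case: eqP => [->|] /=; lia.
  - by rewrite cut_incr_lower; lia.
  - by exists f; split=> // a; have := fB a; rewrite /l'; lia.
move: cutX cutY; rewrite cut_decr_upper cut_incr_lower.
have := cut0 X; have := cut0 Y; have := cut0 (X :&: Y); have := cut0 (X :|: Y).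
(* A cut made negative by moving one bound at e was 0 before and is crossed by e. *)
case eX: (leaves X e); last by rewrite subr0; lia.
case eY: (enters Y e); last by rewrite subr0; lia.
by have := cut_uncross lu eX eY; lia.
Qed.

End Hoffman.

(** * Positions and maximal segments on parallel lines *)

(* Rows are the case [mk i j = (i, j)], columns the case [mk i j = (j, i)]:
   [line p] is the index of the line through p and [co p] its place on it. *)
Section Lines.

Variables (n : nat) (mk : 'I_n -> 'I_n -> pos n) (line co : pos n -> 'I_n).
Hypothesis line_mk : forall i j, line (mk i j) = i.
Hypothesis co_mk : forall i j, co (mk i j) = j.
Hypothesis mk_line_co : forall p, mk (line p) (co p) = p.
Implicit Types (p q : pos n) (X Y C : {set pos n}).

Definition succ p : option (pos n) := omap (mk (line p)) (insub (co p).+1).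

Lemma succ_Some p q :
  (succ p == Some q) = (line p == line q) && ((co p).+1 == co q).
Proof.
rewrite /succ; case: insubP => [j _ j_val|] /=; last first.
  move=> ge_n; apply/esym/negbTE; apply: contra ge_n => /andP[_ /eqP->].
  exact: ltn_ord.
apply/eqP/andP => [[<-]|[/eqP eqi /eqP eqj]].
  by rewrite line_mk co_mk j_val.
rewrite -[q]mk_line_co eqi; congr (Some (mk _ _)).
by apply/val_inj; rewrite /= j_val.
Qed.

Lemma succ_None p : (succ p == None) = ((co p).+1 == n).
Proof.
rewrite /succ; case: insubP => [j lt_n _|ge_n] /=; last first.
  by rewrite eqxx; apply/esym/eqP; have := ltn_ord (co p); lia.
by apply/esym/negbTE; rewrite neq_ltn lt_n.
Qed.

Lemma card_succ_None : #|[set p | succ p == None]| = n.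
Proof.
have [n0|n_gt0] := posnP n.
  rewrite [RHS]n0; apply: eq_card0 => p; have := ltn_ord (co p).
  by rewrite [X in _ < X]n0.
have lt_n : n.-1 < n by rewrite prednK.
rewrite -[RHS](card_ord n) -cardsT -(card_imset setT (f := mk^~ (Ordinal lt_n))).
  apply: eq_card => p; rewrite inE succ_None; apply/eqP/imsetP => [eq_n|[i _ ->]].
    exists (line p); rewrite ?inE // -[LHS]mk_line_co; congr mk.
    by apply/val_inj; rewrite /= -[in RHS]eq_n.
  by rewrite co_mk /= prednK.
by move=> i j /(congr1 line); rewrite !line_mk.
Qed.

(** Unroll conservation back to the first position of the line, which has no predecessor. *)
Lemma prefix_sum (r a : pos n -> int) :
  (forall q, r q = a q + \sum_(p | succ p == Some q) r p)%R ->
  forall i j : 'I_n, (r (mk i j) = \sum_(k < n | (k <= j)%N) a (mk i k))%R.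
Proof.
move=> rE i [m lt_m]; elim: m lt_m => [|m IHm] lt_m.
  rewrite rE big1 => [|p]; last by rewrite succ_Some co_mk andbC.
  rewrite addr0 (big_pred1 (Ordinal lt_m)) // => k /=.
  by rewrite leqn0 -val_eqE.
rewrite rE (big_pred1 (mk i (Ordinal (ltnW lt_m)))) => [|p] /=; last first.
  rewrite succ_Some line_mk co_mk eqSS; apply/andP/eqP => [[/eqP <- /eqP eq_m]|->].
    by rewrite -[LHS]mk_line_co; congr mk; apply/val_inj.
  by rewrite line_mk co_mk.
rewrite IHm [RHS](bigD1 (Ordinal lt_m)) //=; congr (_ + _)%R.
by apply: eq_bigl => k; rewrite -val_eqE /=; lia.
Qed.

(** Convertible to [hsegment] and [vsegment] in the two instances. *)
Definition segment X : bool :=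
  [exists i : 'I_n, exists a : 'I_n, exists b : 'I_n,
     (a <= b) && (X == [set p : pos n | (line p == i) && (a <= co p <= b)])].

Lemma segmentP X :
  reflect (exists i a b : 'I_n,
     a <= b /\ X = [set p : pos n | (line p == i) && (a <= co p <= b)])
    (segment X).
Proof.
apply: (iffP existsP) => [[i /existsP[a /existsP[b /andP[ab /eqP->]]]]|].
  by exists i, a, b.
case=> i [a [b [ab ->]]]; exists i; apply/existsP; exists a; apply/existsP.
by exists b; rewrite ab eqxx.
Qed.

Lemma segment1 p : segment [set p].
Proof.
apply/segmentP; exists (line p), (co p), (co p); split=> //.
apply/setP=> q; rewrite !inE -eqn_leq val_eqE.
apply/eqP/andP => [->|[/eqP eqi /eqP eqj]]; first by rewrite !eqxx.
by rewrite -[q]mk_line_co eqi -eqj mk_line_co.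
Qed.

Lemma segmentU X Y p : segment X -> segment Y -> p \in X -> p \in Y ->
  segment (X :|: Y).
Proof.
move=> /segmentP[i [a [b [ab ->]]]] /segmentP[i' [a' [b' [ab' ->]]]].
rewrite !inE => /andP[/eqP <- p1] /andP[/eqP <- p2].
apply/segmentP; exists (line p).
exists (if a <= a' then a else a'), (if b <= b' then b' else b).
split; first by case: ifP; case: ifP; lia.
apply/setP=> q; rewrite !inE; case: (line q == line p) => //=.
by case: ifP; case: ifP; lia.
Qed.

Lemma segment_last X : segment X ->
  exists2 p, p \in X & forall q, succ p = Some q -> q \notin X /\ segment (q |: X).
Proof.
case/segmentP=> i [a [b [ab ->]]]; exists (mk i b).
  by rewrite inE line_mk co_mk eqxx ab leqnn.
move=> q /eqP; rewrite succ_Some line_mk co_mk => /andP[/eqP iq /eqP bq].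
split; first by rewrite inE -bq ltnn !andbF.
apply/segmentP; exists i, a, (co q); split; first by lia.
apply/setP=> p; rewrite !inE -bq; apply/orP/andP => [[/eqP->|]|[/eqP ip /andP[ap pb]]].
- by rewrite iq eqxx -bq; split=> //; lia.
- by move=> /andP[-> ?]; split=> //; lia.
have [pb'|bp] := leqP (co p) b; [right|left].
  by rewrite ip eqxx; lia.
apply/eqP; rewrite -[p]mk_line_co -[q]mk_line_co ip iq; congr mk.
by apply/val_inj => /=; lia.
Qed.

Definition ends C : {set pos n} :=
  [set p in C | if succ p is Some q then q \notin C else true].

(** Take all maximal segments inside C: two that meet would merge. The last position of each is in
    [ends C], or the segment could be extended, so the blocks of [ends C] exhaust I. *)
Lemma separated_cover C :
  exists2 I : {set {set pos n}}, separated_system segment I &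
    cover I = C /\ #|I| <= #|ends C|.
Proof.
pose inC Y := segment Y && (Y \subset C).
pose I := [set X | maxset inC X].
have IP X : X \in I -> [/\ segment X, X \subset C &
    forall Y, segment Y -> Y \subset C -> X \subset Y -> Y = X].
  rewrite inE => /maxsetP[/andP[sX XC] maxX]; split=> // Y sY YC.
  by apply: maxX; rewrite /inC sY.
have coverI : cover I = C.
  apply/eqP; rewrite eqEsubset; apply/andP; split.
    by apply/bigcupsP => X /IP[].
  apply/subsetP => p pC.
  have [|X maxX] := @maxset_exists _ inC [set p].
    by rewrite /inC segment1 sub1set.
  by rewrite sub1set => pX; apply/bigcupP; exists X; rewrite // inE.
have trivI : trivIset I.
  apply/trivIsetP => X Y XI YI; apply: contraR => /pred0Pn[p /andP[/= pX pY]].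
  have [sX XC maxX] := IP X XI; have [sY YC maxY] := IP Y YI.
  have sXY := segmentU sX sY pX pY; have XYC : X :|: Y \subset C by rewrite subUset XC.
  by rewrite -(maxX _ sXY XYC (subsetUl X Y)) (maxY _ sXY XYC (subsetUr X Y)).
exists I; last split=> //.
  by split=> // X; rewrite coverI inE.
have sub : I \subset pblock I @: ends C.
  apply/subsetP => X XI; have [sX XC maxX] := IP X XI.
  have [p pX succX] := segment_last sX.
  apply/imsetP; exists p; last by rewrite (def_pblock trivI XI pX).
  rewrite inE (subsetP XC) //=; case nE: (succ p) => [q|//].
  have [qX sqX] := succX q nE; apply: contra qX => qC.
  by rewrite -(maxX _ sqX) ?subsetU1 ?setU11 // subUset sub1set qC.
exact: leq_trans (subset_leq_card sub) (leq_imset_card _ _).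
Qed.

End Lines.

(** * Alternating sequences and their partial sums *)

Section AlternatingSequences.
Local Open Scope ring_scope.

Variables (n : nat) (f : 'I_n -> int).

Definition alternates : Prop := forall j k : 'I_n, (j < k)%N ->
  f j != 0 -> f k != 0 -> (forall l : 'I_n, (j < l < k)%N -> f l = 0) ->
  f j * f k < 0.

(** Consecutive nonzero terms cancel, which leaves at most a single 1. *)
Lemma alternates_interval_sum (a b : 'I_n) :
  (forall j, f j \in [:: 0; 1; -1]) -> alternates ->
  \sum_(k < n | (a <= k <= b)%N) f k <= 1.
Proof.
move=> fE alt; pose T m := \sum_(k < n | (a <= k < m)%N) f k.
(* A partial sum is bounded according to the sign of its last nonzero term. *)
pose last_sign m := exists j : 'I_n, [/\ (j < m)%N, f j != 0,
  forall l : 'I_n, (j < l < m)%N -> f l = 0 & T m <= (f j == 1)%:R].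
have inv m : (m <= n)%N ->
    (forall l : 'I_n, (a <= l < m)%N -> f l = 0) \/ last_sign m.
  elim: m => [|m IHm] lt_m; first by left=> l; lia.
  have [lt_ma|le_am] := ltnP m a; first by left=> l; lia.
  pose k := Ordinal lt_m.
  have TS : T m.+1 = f k + T m.
    rewrite /T (bigD1 k) /=; last by rewrite le_am ltnSn.
    by congr (_ + _); apply: eq_bigl => l; rewrite -val_eqE /=; lia.
  have eq_k (l : 'I_n) : l = m :> nat -> l = k by move=> lm; apply/val_inj.
  have := fE k; rewrite !inE.
  have [fk0 _|fk0 fkE] := eqVneq (f k) 0.
    have [z|[j [jm fj z Tj]]] := IHm (ltnW lt_m).
      left=> l /andP[al]; rewrite ltnS leq_eqVlt => /orP[/eqP/eq_k->//|lm].
      by apply: z; rewrite al.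
    right; exists j; split=> //; first exact: ltnW.
      move=> l /andP[jl]; rewrite ltnS leq_eqVlt => /orP[/eqP/eq_k->//|lm].
      by apply: z; rewrite jl.
    by rewrite TS fk0 add0r.
  right; exists k; split=> //=; first by move=> l; lia.
  rewrite TS; have [z|[j [jm fj z Tj]]] := IHm (ltnW lt_m).
    rewrite /T big1 ?addr0; last by move=> l; apply: z.
    by move: fkE => /= /orP[]/eqP->.
  have fjk := alt j k jm fj fk0 z.
  have := fE j; rewrite !inE (negPf fj) /=.
  by move: fkE fjk Tj => /= /orP[]/eqP-> + + /orP[]/eqP fjE; rewrite fjE /=; lia.
have -> : \sum_(k < n | (a <= k <= b)%N) f k = T b.+1 by [].
have [z|[j [_ _ _]]] := inv b.+1 (ltn_ord b).
  by rewrite /T big1 // => l; apply: z.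
by case: (_ == _) => //=; lia.
Qed.

(** Terms are differences of numbers in {0, 1}. Prefix sums stay constant between consecutive
    nonzero terms, so two equal steps would leave {0, 1}. *)
Lemma prefix_sums_alternate :
  (forall j : 'I_n, 0 <= \sum_(k < n | (k <= j)%N) f k <= 1) ->
  (forall j, f j \in [:: 0; 1; -1]) /\ alternates.
Proof.
pose T m := \sum_(k < n | (k < m)%N) f k => T01.
have {}T01 m : (m <= n)%N -> 0 <= T m <= 1.
  case: m => [|m lt_m]; last exact: (T01 (Ordinal lt_m)).
  by rewrite /T big_pred0.
have TS (k : 'I_n) : T k.+1 = f k + T k.
  rewrite /T (bigD1 k) //=; congr (_ + _).
  by apply: eq_bigl => l; rewrite -val_eqE /=; lia.
have fE j : f j \in [:: 0; 1; -1].
  have := T01 j.+1 (ltn_ord j); have := T01 j (ltnW (ltn_ord j)).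
  by rewrite TS !inE; lia.
split=> // j k jk fj fk z.
have Tjk : T k = T j.+1.
  rewrite /T [RHS]big_mkcond [LHS]big_mkcond; apply: eq_bigr => l _.
  rewrite ltnS; have [lj|jl] := leqP l j; first by rewrite (leq_ltn_trans lj jk).
  by case: ifP => // lk; rewrite z ?jl.
have := T01 j (ltnW (ltn_ord j)); have := T01 k.+1 (ltn_ord k).
have := T01 k (ltnW (ltn_ord k)).
rewrite TS Tjk TS; move: (fE j) (fE k); rewrite !inE (negPf fj) (negPf fk) /=.
by move=> /orP[]/eqP-> /orP[]/eqP->; lia.
Qed.

End AlternatingSequences.

Lemma segments_sum_le_card (n : nat) (mk : 'I_n -> 'I_n -> pos n)
    (line co : pos n -> 'I_n) (F : pos n -> int) (I : {set {set pos n}}) :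
  (forall i j, line (mk i j) = i) -> (forall i j, co (mk i j) = j) ->
  (forall p, mk (line p) (co p) = p) ->
  (forall i j, F (mk i j) \in [:: 0; 1; -1]%R) ->
  (forall i, alternates (fun j => F (mk i j))) ->
  separated_system (segment line co) I ->
  (\sum_(p in cover I) F p <= #|I|%:R)%R.
Proof.
move=> line_mk co_mk mk_line_co FE alt [trivI maxI].
rewrite big_trivIset // -sum1_card natr_sum /=; apply: ler_sum => X XI.
have /maxsetP[/andP[/segmentP[i [a [b [_ ->]]]] _] _] := maxI X XI.
have := alternates_interval_sum a b (FE i) (alt i); congr (_ <= _)%R.
rewrite [RHS](reindex_onto (mk i) co) => [|p]; last first.
  by rewrite inE => /andP[/eqP <- _].
by apply: eq_bigl => k; rewrite inE line_mk co_mk !eqxx andbT.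
Qed.

(** * The network and its cuts *)

Section Network.
Local Open Scope ring_scope.

Variables (n : nat) (S : label -> {set pos n}).
Implicit Types (p q : pos n) (C : {set pos n}).

Definition hpos (i j : 'I_n) : pos n := (i, j).
Definition vpos (j i : 'I_n) : pos n := (i, j).
Definition row p : 'I_n := p.1.
Definition col p : 'I_n := p.2.

Lemma hposK p : hpos (row p) (col p) = p. Proof. by case: p. Qed.
Lemma vposK p : vpos (col p) (row p) = p. Proof. by case: p. Qed.

Definition hsucc : pos n -> option (pos n) := succ hpos row col.
Definition vsucc : pos n -> option (pos n) := succ vpos col row.
Definition hends : {set pos n} -> {set pos n} := ends hpos row col.
Definition vends : {set pos n} -> {set pos n} := ends vpos col row.

(* Node [inl p] lies on the row through p, node [inr p] on its column. The arcs
   [inl (inl p)] carry the row prefix sums, the arcs [inl (inr p)] the column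
   prefix sums (directed upwards), and the arcs [inr p] the matrix entries. *)
Definition node : finType := (pos n + pos n)%type.
Definition arc : finType := (pos n + pos n + pos n)%type.

Definition arc_src (e : arc) : option node :=
  match e with
  | inl (inl p) => Some (inl p)
  | inl (inr p) => omap inr (vsucc p)
  | inr p => Some (inr p)
  end.

Definition arc_tgt (e : arc) : option node :=
  match e with
  | inl (inl p) => omap inl (hsucc p)
  | inl (inr p) => Some (inr p)
  | inr p => Some (inl p)
  end.

(* Stands for infinity in the bounds on the entries. *)
Definition big_bound : int := (n + #|{: pos n}|)%:R.

(** [PlusOne] is bounded only below and [MinusOne] only above, which fixes entries known to be in
    {0, 1, -1}. So lower bounds are finite exactly where feasibility allows double cover, upper
    bounds where it allows no cover. *)
Definition entry_lo p : int :=
  if p \in S PlusOne then 1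
  else if p \in S Zero :|: S NonNeg then 0 else - big_bound.

Definition entry_up p : int :=
  if p \in S MinusOne then -1
  else if p \in S Zero :|: S NonPos then 0 else big_bound.

(** The lower bound 1 on the last arc of a line forces its total to be 1. *)
Definition arc_lo (e : arc) : int :=
  match e with
  | inl (inl p) => (hsucc p == None)%:R
  | inl (inr p) => (vsucc p == None)%:R
  | inr p => entry_lo p
  end.

Definition arc_up (e : arc) : int := if e is inr p then entry_up p else 1.

Lemma card_indicator C : #|C|%:R = \sum_p (p \in C)%:R :> int.
Proof.
by rewrite -sum1_card natr_sum big_mkcond; apply: eq_bigr => p _; case: (p \in C).
Qed.

(** The entry arc at p leaves X if p is in neither C1 nor C2 and enters X if p is in both. The last
    column arcs come from outside with lower bound 1, whence the term -n. *)
Lemma cut_network (X : {set node}) (C1 := [set p | inl p \in X])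
    (C2 := [set p | inr p \notin X]) :
  cut arc_src arc_tgt arc_lo arc_up X =
  #|hends C1|%:R + #|vends C2|%:R - n%:R +
  \sum_p (entry_up p *+ (p \in ~: (C1 :|: C2)) - entry_lo p *+ (p \in C1 :&: C2)).
Proof.
have nE : n%:R = \sum_p (vsucc p == None)%:R :> int.
  transitivity (#|[set p | vsucc p == None]|%:R : int).
    by rewrite card_succ_None //; apply: vposK.
  by rewrite card_indicator; apply: eq_bigr => p _; rewrite inE.
rewrite nE !card_indicator -[_ + _ - _]addrA -sumrB /cut !big_sumType /=.
congr (_ + _ + _).
- apply: eq_bigr => p _; rewrite /leaves /enters /= !inE -/(hsucc p).
  case: (hsucc p) => [q|] /=; rewrite ?inE ?mulr0n ?mul0rn ?subr0 //=.
  by rewrite andbF subr0.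
- apply: eq_bigr => p _; rewrite /leaves /enters /= !inE -/(vsucc p).
  case: (vsucc p) => [q|] /=; rewrite ?inE ?negbK ?mul0rn ?subr0 //=.
    by rewrite andbC.
  by case: (inr p \in X).
- apply: eq_bigr => p _; rewrite /leaves /enters /= !inE negb_or !negbK.
  by case: (inl p \in X); case: (inr p \in X).
Qed.

Lemma cut_network_setT : cut arc_src arc_tgt arc_lo arc_up setT = 0.
Proof.
rewrite cut_network big1 ?addr0 => [|p _]; last by rewrite !inE ?mulr0n subrr.
have -> : hends [set p | inl p \in [set: node]] = [set p | hsucc p == None].
  apply/setP => p; rewrite !inE -/(hsucc p).
  by case: (hsucc p) => [q|]; rewrite ?inE.
have -> : vends [set p | inr p \notin [set: node]] = set0.
  by apply/setP => p; rewrite !inE.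
rewrite card_succ_None // => [|p]; last exact: hposK.
by rewrite cards0 addr0 subrr.
Qed.

Lemma cut_network_ge0 :
  (forall I1 I2 : {set {set pos n}},
     separated_family I1 I2 -> feasible S I1 I2 ->
     (n + #|S MinusOne :&: uncovered I1 I2| + #|S PlusOne :&: twice_covered I1 I2|
       <= #|I1| + #|I2|)%N) ->
  forall X, 0 <= cut arc_src arc_tgt arc_lo arc_up X.
Proof.
move=> cond X; rewrite cut_network; set C1 := [set p | _]; set C2 := [set p | _].
clearbody C1 C2.
have [I1 sep1 [cov1 card1]] :=
  @separated_cover n hpos row col (fun _ _ => erefl) (fun _ _ => erefl) hposK C1.
have [I2 sep2 [cov2 card2]] :=
  @separated_cover n vpos col row (fun _ _ => erefl) (fun _ _ => erefl) vposK C2.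
rewrite -/(hends C1) in card1; rewrite -/(vends C2) in card2.
set sum := \sum_p _.
suff: n%:R <= #|I1|%:R + #|I2|%:R + sum by lia.
have [/andP[feas0 feas2]|] := boolP
  ((~: (C1 :|: C2) \subset S Zero :|: S MinusOne :|: S NonPos) &&
   (C1 :&: C2 \subset S Zero :|: S PlusOne :|: S NonNeg)).
  have {}cond := cond I1 I2 (conj sep1 sep2).
  rewrite /feasible /uncovered /twice_covered cov1 cov2 in cond.
  have := cond (conj feas0 feas2).
  set k0 := #|S MinusOne :&: _|; set k1 := #|S PlusOne :&: _| => {}cond.
  (* For a feasible family a position contributes -1 if it is counted in [k0] or [k1], and 0
     otherwise. *)
  suff: - (k0%:R + k1%:R) <= sum by lia.
  rewrite !card_indicator -big_split -sumrN; apply: ler_sum => p _.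
  have := subsetP feas0 p; have := subsetP feas2 p.
  rewrite /entry_up /entry_lo !inE.
  case: (p \in C1); case: (p \in C2) => //= feas2p feas0p; rewrite ?andbF ?andbT //=.
    have := feas2p isT; case: (p \in S PlusOne); rewrite ?orbT ?orbF //= => ->; lia.
  have := feas0p isT; case: (p \in S MinusOne); rewrite ?orbT ?orbF //= => ->; lia.
have big_ge0 : 0 <= big_bound by [].
pose g p := entry_up p *+ (p \in ~: (C1 :|: C2)) - entry_lo p *+ (p \in C1 :&: C2).
have g_ge p : -1 <= g p.
  have lo1 : entry_lo p <= 1 by rewrite /entry_lo; do 2?case: ifP => _; lia.
  have up1 : -1 <= entry_up p by rewrite /entry_up; do 2?case: ifP => _; lia.
  by rewrite /g !inE; case: (p \in C1); case: (p \in C2) => //=; lia.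
rewrite negb_and => infeas.
(* Infeasibility puts an infinite bound on an uncovered or twice covered position. *)
have [p0 gp0] : exists p0, g p0 = big_bound.
  case/orP: infeas => /subsetPn[p pI]; rewrite !inE !negb_or -andbA => /and3P[p1 p2 p3];
  exists p; rewrite /g /entry_up /entry_lo; move: pI; rewrite !inE.
    move=> /norP[/negPf-> /negPf->].
    by rewrite /= (negPf p1) (negPf p2) (negPf p3) /=; lia.
  by move=> /andP[-> ->]; rewrite /= (negPf p1) (negPf p2) (negPf p3) /=; lia.
(* The other positions lose at most 1 each, and [big_bound] is chosen to leave n. *)
suff: big_bound - #|{: pos n}|%:R <= sum by rewrite /big_bound; lia.
rewrite /sum (bigD1 p0) //= -/(g p0) gp0 lerD2l.
have : \sum_(p | p != p0) - (1 : int) <= \sum_(p | p != p0) g p.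
  by apply: ler_sum => p _; apply: g_ge.
apply: le_trans; rewrite sumrN lerN2 -[in leRHS]sum1_card natr_sum.
by rewrite [leRHS](bigD1 p0) //= lerDr.
Qed.

Hypothesis partS : is_partition S.

Lemma partition_notin p a b : a <> b -> p \in S a -> p \notin S b.
Proof.
case: partS => disj _ ab pa; apply/negP => pb.
by have /pred0P/(_ p) := disj a b ab; rewrite /= pa pb.
Qed.

Lemma entry_lo_le_up p : entry_lo p <= entry_up p.
Proof.
have big_ge1 : 1 <= big_bound.
  by rewrite ler1n addn_gt0 (leq_ltn_trans _ (ltn_ord p.1)).
rewrite /entry_lo /entry_up !inE.
case: ifP => [p1|_].
  rewrite (negPf (@partition_notin p PlusOne MinusOne _ p1)) //.
  rewrite (negPf (@partition_notin p PlusOne Zero _ p1)) //.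
  rewrite (negPf (@partition_notin p PlusOne NonPos _ p1)) //.
case: ifP => [/orP[]p1|_].
- by rewrite (negPf (@partition_notin p _ MinusOne _ p1)) // p1.
- by rewrite (negPf (@partition_notin p _ MinusOne _ p1)) //; case: ifP.
by case: ifP => _; [|case: ifP => _]; lia.
Qed.

(** Column arcs point upwards so that the entry, which leaves its column node, still adds to the
    column prefix sum. *)
Lemma network_flow :
  (forall X, 0 <= cut arc_src arc_tgt arc_lo arc_up X) ->
  exists r c a : pos n -> int,
  [/\ forall p, (hsucc p == None)%:R <= r p <= 1,
      forall p, (vsucc p == None)%:R <= c p <= 1,
      forall p, entry_lo p <= a p <= entry_up p,
      forall q, r q = a q + \sum_(p | hsucc p == Some q) r p
    & forall q, c q = a q + \sum_(p | vsucc p == Some q) c p].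
Proof.
move=> cut_ge0; have [||f [fB fC]] := hoffman_flow _ cut_ge0.
- by case=> [[]|] p /=; [case: (_ == _)..|exact: entry_lo_le_up].
- by rewrite cut_network_setT.
exists (fun p => f (inl (inl p))), (fun p => f (inl (inr p))), (fun p => f (inr p)).
have omapE (T U : eqType) (g : T -> U) (o : option T) x :
  injective g -> (omap g o == Some (g x)) = (o == Some x).
  by case: o => //= y inj_g; apply/eqP/eqP => [[/inj_g->]|[->]].
have omapF (T U : eqType) (g : T -> U) (o : option T) y :
  (forall x, g x != y) -> (omap g o == Some y) = false.
  by case: o => //= x /(_ x) gxy; apply/eqP => -[gx]; rewrite gx eqxx in gxy.
split=> [p|p|p|q|q]; try exact: fB.
- have := fC (inl q); rewrite !big_sumType /=.
  rewrite (big_pred1 q) // big_pred0 => [|p]; last exact: omapF.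
  rewrite big_pred0 // !addr0 => ->.
  rewrite [X in _ + X + _]big_pred0 // addr0 addrC (big_pred1 q) //; congr (_ + _).
  by apply: eq_bigl => p; apply: omapE => ? ? [].
- have := fC (inr q); rewrite !big_sumType /=.
  rewrite big_pred0 // add0r [X in _ + X](big_pred1 q) //.
  rewrite [X in _ = X + _ + _]big_pred0 => [|p]; last exact: omapF.
  rewrite add0r [X in _ = X + _](big_pred1 q) // [X in _ = _ + X]big_pred0 //.
  rewrite addr0 => <-; rewrite addrC; congr (_ + _).
  by apply: eq_bigl => p; apply: omapE => ? ? [].
Qed.

End Network.

(** * From flows to ASMs, and from ASMs to the inequality *)

Lemma ASM_of_prefix_sums (n : nat) (A : 'M[int]_n) (r : 'I_n -> 'I_n -> int) :
  (forall i j : 'I_n, ((j.+1 == n)%:R <= r i j <= 1)%R) ->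
  (forall i j, r i j = \sum_(k < n | (k <= j)%N) A i k)%R ->
  [/\ forall i j, A i j \in [:: 0; 1; -1]%R, forall i, (\sum_j A i j = 1)%R
    & rows_alternate A].
Proof.
move=> rB rE; have alt i : (forall j, A i j \in [:: 0; 1; -1]%R) /\ alternates (A i).
  by apply: prefix_sums_alternate => j; rewrite -rE; have := rB i j; lia.
split=> [i|i|i]; [exact: (alt i).1| |exact: (alt i).2].
have lt_n : n.-1 < n by rewrite prednK //; apply: leq_ltn_trans (ltn_ord i).
have := rB i (Ordinal lt_n); rewrite /= prednK ?(leq_ltn_trans _ (ltn_ord i)) //.
rewrite eqxx rE => /le_anti eq1; apply: etrans (esym eq1); apply: eq_bigl => k /=.
by have := ltn_ord k; lia.
Qed.

(** The sums over the two covers add up to n plus the twice covered entries minus the uncovered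
    ones. By feasibility the former are nonnegative, and 1 on [S PlusOne]; the latter are
    nonpositive, and -1 on [S MinusOne]. *)
Lemma ASM_segments_bound (n : nat) (S : label -> {set pos n}) (A : 'M[int]_n)
    (I1 I2 : {set {set pos n}}) :
  is_ASM A -> compatible S A ->
  separated_family I1 I2 -> feasible S I1 I2 ->
  n + #|S MinusOne :&: uncovered I1 I2| + #|S PlusOne :&: twice_covered I1 I2|
    <= #|I1| + #|I2|.
Proof.
move=> [AE rowA colA altA altAT] [c0 c1 cm1 cnn cnp] [sep1 sep2] [feas0 feas2].
pose F (p : pos n) := A p.1 p.2.
have le1 : (\sum_(p in cover I1) F p <= #|I1|%:R)%R.
  apply: (@segments_sum_le_card n (@hpos n) (@row n) (@col n)) => //.
  by case.
have le2 : (\sum_(p in cover I2) F p <= #|I2|%:R)%R.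
  apply: (@segments_sum_le_card n (@vpos n) (@col n) (@row n)) => //.
  - by case.
  - by move=> j i; apply: AE.
  by move=> j i k ik; have := altAT j i k ik; rewrite !mxE => alt ? ? z;
    apply: alt => // l /z; rewrite !mxE.
have sumF : (\sum_p F p = n%:R)%R.
  rewrite -(pair_bigA _ (fun i j => A i j)) /= (eq_bigr (fun=> 1%R)) //.
  by rewrite sumr_const card_ord.
rewrite -(ler_nat int) !natrD; apply: le_trans (lerD le1 le2).
rewrite -sumF !card_indicator -!big_split /= [X in (_ <= X + _)%R]big_mkcond.
rewrite [X in (_ <= _ + X)%R]big_mkcond -big_split /=; apply: ler_sum => p _.
have := subsetP feas0 p; have := subsetP feas2 p; rewrite !inE.
have := c0 p; have := c1 p; have := cm1 p; have := cnn p; have := cnp p.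
rewrite -/(F p).
case: (p \in cover I1); case: (p \in cover I2) => /= Hnp Hnn Hm1 H1 H0 f2 f0;
  rewrite ?andbF ?andbT ?addr0 ?add0r //.
- case p1: (p \in S PlusOne); first by rewrite (H1 p1).
  rewrite addr0 lerDl; case/orP: (f2 isT) => [|/Hnn//]; rewrite p1 orbF => /H0->.
  exact: lexx.
- case p1: (p \in S MinusOne); first by rewrite (Hm1 p1).
  rewrite addr0; case/orP: (f0 isT) => [|/Hnp//]; rewrite p1 orbF => /H0->.
  exact: lexx.
Qed.

Theorem theorem6p2 (n : nat) (hn : 0 < n) (S : label -> {set pos n})
    (hS : is_partition S) :
  (exists A : 'M[int]_n, is_ASM A /\ compatible S A) <->
  (forall I1 I2 : {set {set pos n}},
     separated_family I1 I2 -> feasible S I1 I2 ->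
     n + #|S MinusOne :&: uncovered I1 I2| + #|S PlusOne :&: twice_covered I1 I2|
       <= #|I1| + #|I2|).
Proof.
split=> [[A [asmA compA]] I1 I2 sepI feasI|/cut_network_ge0 cut_ge0].
  exact: ASM_segments_bound compA sepI feasI.
have [r [c [a [rB cB aB rE cE]]]] := network_flow hS cut_ge0.
pose A := (\matrix_(i, j) a (i, j))%R.
have [|i j|AE rowA altA] := @ASM_of_prefix_sums n A (fun i j => r (hpos i j)).
- by move=> i j; have := rB (hpos i j); rewrite succ_None.
- rewrite (prefix_sum _ _ (@hposK n) rE) //.
  by apply: eq_bigr => k _; rewrite mxE.
have [|j i|_ colA altAT] := @ASM_of_prefix_sums n A^T%R (fun j i => c (vpos j i)).
- by move=> j i; have := cB (vpos j i); rewrite succ_None.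
- rewrite (prefix_sum _ _ (@vposK n) cE) //.
  by apply: eq_bigr => k _; rewrite !mxE.
exists A; split.
  split=> // j; rewrite -(colA j); apply: eq_bigr => i _.
  by rewrite [RHS]mxE.
have Ap p : A p.1 p.2 = a p by rewrite mxE -surjective_pairing.
have notin := @partition_notin n S hS.
(* The one-sided bounds decide each label, since entries are in {0, 1, -1}. *)
split=> p pS; have := aB p; have := AE p.1 p.2; rewrite Ap /entry_lo /entry_up !inE pS.
- rewrite (negPf (notin p Zero PlusOne _ pS)) //.
  by rewrite (negPf (notin p Zero MinusOne _ pS)) //=; lia.
- by lia.
- by lia.
- by rewrite (negPf (notin p NonNeg PlusOne _ pS)) // orbT /=; lia.
- by rewrite (negPf (notin p NonPos MinusOne _ pS)) // orbT /=; lia.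
Qed.
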